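(* Let $(A,+,\cdot,0)$ be a ring and let $\alpha,\beta:A\to A$ be two commuting ring homomorphisms. Define a new addition and a new multiplication on $A$ by $x\,\widetilde{+}\,y=\alpha(x+y)=\alpha(x)+\alpha(y)$ and $x\,\widetilde{\cdot}\,y=\beta(x\cdot y)=\beta(x)\cdot\beta(y)$ for all $x,y\in A$. Then $(A,\widetilde{+},\widetilde{\cdot},0,\alpha,\beta)$ is a Hom-ring of type $(1)$.
   Context: An abelian Hom-group $(A,+,0,\alpha)$ is a set $A$ with an element $0$, a commutative operation $+$ and a map $\alpha:A\to A$ such that for all $x,y,z$: $\alpha(x)+(y+z)=(x+y)+\alpha(z)$; $\alpha(x+y)=\alpha(x)+\alpha(y)$; $x+0=0+x=\alpha(x)$, $\alpha(0)=0$; there is a map $x\mapsto -x$ with $-(x+y)=(-y)+(-x)$; and for each $x$ there is a natural number $k$ with $\alpha^k(x+(-x))=\alpha^k((-x)+x)=0$. A Hom-ring of type $(1)$ is a tuple $(A,+,\cdot,0,\alpha,\beta)$ with binary operations $+,\cdot$ and maps $\alpha,\beta:A\to A$ such that for all $x,y,z\in A$: (1) $(A,+,0,\alpha)$ is an abelian Hom-group; (2) $\beta(x+y)=\beta(x)+\beta(y)$ and $\alpha\circ\beta=\beta\circ\alpha$; (3) $\alpha(xy)=\alpha(x)\alpha(y)$ and $\beta(xy)=\beta(x)\beta(y)$; (4) $\beta(x)\cdot(y\cdot z)=(x\cdot y)\cdot\beta(z)$; (5) $\alpha(x)\cdot(y+z)=x\cdot y+x\cdot z$ and $(y+z)\cdot\alpha(x)=y\cdot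 x+z\cdot x$. *)

(* Defs.v *)
From mathcomp Require Import all_boot all_order all_algebra.
Set Implicit Arguments.
Unset Strict Implicit.
Unset Printing Implicit Defensive.
Import GRing.Theory.
Local Open Scope ring_scope.

Record abelian_hom_group (A : Type) (add : A -> A -> A) (zero : A)
    (alpha : A -> A) : Prop := AbelianHomGroup {
  hg_addC : commutative add;
  hg_hom_addA : forall x y z, add (alpha x) (add y z) = add (add x y) (alpha z);
  hg_alphaD : {morph alpha : x y / add x y};
  hg_addr0 : forall x, add x zero = alpha x;
  hg_add0r : forall x, add zero x = alpha x;
  hg_alpha0 : alpha zero = zero;
  hg_opp : exists opp : A -> A,
    (forall x y, opp (add x y) = add (opp y) (opp x)) /\
    (forall x, exists k : nat,
       iter k alpha (add x (opp x)) = zero /\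
       iter k alpha (add (opp x) x) = zero) }.

Record hom_ring_type1 (A : Type) (add mul : A -> A -> A) (zero : A)
    (alpha beta : A -> A) : Prop := HomRingType1 {
  hr_add : abelian_hom_group add zero alpha;
  hr_betaD : {morph beta : x y / add x y};
  hr_comm : alpha \o beta =1 beta \o alpha;
  hr_alphaM : {morph alpha : x y / mul x y};
  hr_betaM : {morph beta : x y / mul x y};
  hr_hom_mulA : forall x y z, mul (beta x) (mul y z) = mul (mul x y) (beta z);
  hr_mulDr : forall x y z, mul (alpha x) (add y z) = add (mul x y) (mul x z);
  hr_mulDl : forall x y z, mul (add y z) (alpha x) = add (mul y x) (mul z x) }.

(* Rings are associative but need not be unital: MathComp's ring structures
   all have a unit, hence a separate predicate on the additive group A. *)
Record is_ring (A : zmodType) (mul : A -> A -> A) : Prop := IsRing {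
  ring_mulA : associative mul;
  ring_mulDl : left_distributive mul +%R;
  ring_mulDr : right_distributive mul +%R }.

Record is_ring_hom (A : zmodType) (mul : A -> A -> A) (f : A -> A) : Prop :=
  IsRingHom {
  ring_homD : {morph f : x y / x + y};
  ring_homM : {morph f : x y / mul x y} }.

Definition twist (A : Type) (f : A -> A) (op : A -> A -> A) : A -> A -> A :=
  fun x y => f (op x y).

(* Main.v *)
Require Import Defs.
From mathcomp Require Import all_boot all_order all_algebra.
Import GRing.Theory.
Local Open Scope ring_scope.

(** Twisting by an endomorphism [f] of an operation inserts one application of
    [f] at each node of an expression.  Since [f] distributes over the
    operation, these applications can be pushed to the leaves, and an identity
    survives the twist as soon as each variable receives the same composite of
    twisting maps on both sides.  The maps in the Hom-axioms are there to
    balance these composites: in Hom-associativity every leaf ends up under [f]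
    twice ([twist_hom_assoc], used for both operations), and in
    Hom-distributivity every leaf ends up under both [alpha] and [beta], which
    may be exchanged because they commute.  In the additive Hom-group the
    opposite is the ordinary one, and its defining condition holds already with
    no iteration of [alpha]. *)

(** Both sides are [f (f _)] of the two bracketings of [op x (op y z)]: the
    outer leaf gets its second [f] from the Hom-axiom, the inner leaves from
    the nested twist. *)
Lemma twist_hom_assoc {T : Type} {op : T -> T -> T} {f : T -> T} :
    associative op -> {morph f : x y / op x y} ->
  forall x y z,
    twist f op (f x) (twist f op y z) = twist f op (twist f op x y) (f z).
Proof. by move=> opA fM x y z; rewrite /twist -!fM opA. Qed.

Lemma twist_morph {T : Type} {op : T -> T -> T} {f g : T -> T} :
    f \o g =1 g \o f -> {morph g : x y / op x y} ->
  {morph g : x y / twist f op x y}.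
Proof. by move=> fg gM x y; rewrite /twist -gM; apply/esym/fg. Qed.

Lemma twist_abelian_hom_group (A : zmodType) (alpha : A -> A) :
    {morph alpha : x y / x + y} ->
  abelian_hom_group (twist alpha +%R) 0 alpha.
Proof.
move=> alphaD.
have alpha0 : alpha 0 = 0 by apply: (addrI (alpha 0)); rewrite -alphaD !addr0.
have alphaN x : alpha (- x) = - alpha x.
  by apply: (addrI (alpha x)); rewrite -alphaD !subrr.
split=> //.
- by move=> x y; rewrite /twist addrC.
- exact: (twist_hom_assoc (@addrA A) alphaD).
- exact: (twist_morph (fun=> erefl) alphaD).
- by move=> x; rewrite /twist addr0.
- by move=> x; rewrite /twist add0r.
exists -%R; split=> [x y | x].
  by rewrite /twist -alphaN opprD addrC.
by exists 0%N; rewrite /twist /= subrr addNr.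
Qed.

Theorem proposition6p11 (A : zmodType) (mul : A -> A -> A) (alpha beta : A -> A)
    (ring_A : is_ring mul)
    (hom_alpha : is_ring_hom mul alpha) (hom_beta : is_ring_hom mul beta)
    (comm_alpha_beta : alpha \o beta =1 beta \o alpha) :
  [/\ forall x y, twist alpha +%R x y = alpha x + alpha y,
      forall x y, twist beta mul x y = mul (beta x) (beta y) &
      hom_ring_type1 (twist alpha +%R) (twist beta mul) 0 alpha beta].
Proof.
case: ring_A hom_alpha hom_beta => mulA mulDl mulDr [alphaD alphaM] [betaD betaM].
have alpha_beta x : alpha (beta x) = beta (alpha x) := comm_alpha_beta x.
split; [by move=> x y; apply: alphaD | by move=> x y; apply: betaM | split=> //].
- exact: twist_abelian_hom_group.
- exact: (twist_morph comm_alpha_beta betaD).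
- exact: (twist_morph (fsym comm_alpha_beta) alphaM).
- exact: (twist_morph (fun=> erefl) betaM).
- exact: (twist_hom_assoc mulA betaM).
- by move=> x y z; rewrite /twist -alphaM mulDr -betaD alpha_beta.
- by move=> x y z; rewrite /twist -alphaM mulDl -betaD alpha_beta.
Qed.
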